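(* Let $V$ be a finite set with $m=|V|$ points and let $(V,B)$ be a quasi-symmetric $2$-$(m,S,\Lambda)$ design with intersection numbers $\beta<\alpha$ (equivalently, a coherent configuration of type $(2,2;3)$ on $V\cup B$ with fibers $V$ and $B$). Let $\Gamma$ be its block graph, let $r$ be its second largest eigenvalue and $E_r$ the orthogonal projection of $\mathbb{R}^B$ onto the $r$-eigenspace of the adjacency matrix of $\Gamma$; this eigenspace has dimension $m-1$. Then there is a map $i: V\cup B\to\mathbb{R}^{d}$, $d=m-1$, such that, writing $X_1=i(V)$ and $X_2=i(B)$: (1) $X_1$ is the vertex set of a regular simplex (with $m$ vertices) in $\mathbb{R}^d$; (2) $X_2$ is a scaling of the spherical embedding of $\Gamma$ in $\mathbb{R}^d$, i.e. there are a point $o\in\mathbb{R}^d$, a constant $c>0$ and a linear isometry $\varphi$ from the $r$-eigenspace onto $\mathbb{R}^d$ with $i(b)=o+c\,\varphi(E_r e_b)$ for all $b\in B$ ($e_b$ the standard basis vectors of $\mathbb{R}^B$); (3) for $v\in V$ and $b\in B$, the distance $\|i(v)-i(b)\|$ depends only on whether $v\in b$ or $v\notin b$; (4) $|A(X_1,X_1)|=1$ and $|A(X_1,X_2)|=|A(X_2,X_2)|=2$.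
   Context: For finite $X,Y\subset\mathbb{R}^d$, $A(X,Y)=\{\|x-y\|: x\in X, y\in Y, x\neq y\}$. A $2$-$(m,S,\Lambda)$ design is a collection $B$ of $S$-element subsets (blocks) of an $m$-set $V$ such that every $2$-subset of $V$ lies in exactly $\Lambda$ blocks; it is quasi-symmetric if $|b\cap b'|$ for distinct blocks $b,b'$ takes exactly two values $\beta<\alpha$ (the intersection numbers). The block graph has vertex set $B$, with $b\sim b'$ iff $|b\cap b'|=\alpha$; it is a strongly regular graph (neither complete nor empty) with eigenvalues $k>r>s$. By Higman, coherent configurations of type $(2,2;3)$ with fibers $V,B$ are the same as quasi-symmetric $2$-designs on $V$ with block set $B$, the relations being: equality on $V$, equality on $B$, distinctness on $V$, the two intersection-size relations on $B$, incidence and non-incidence between $V$ and $B$ (and their transposes). *)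

(* Defs.v *)
From mathcomp Require Import all_boot all_order all_algebra.
From mathcomp Require Import finmap reals.

Set Implicit Arguments.
Unset Strict Implicit.
Unset Printing Implicit Defensive.

Import Order.TTheory GRing.Theory Num.Theory.

Local Open Scope ring_scope.

(* The norm that MathComp-Analysis puts on matrices is the sup norm, hence a
   separate Euclidean norm. *)
Definition enorm (R : realType) (d : nat) (x : 'rV[R]_d) : R :=
  Num.sqrt (\sum_(j < d) x 0 j ^+ 2).

Definition distances (R : realType) (d : nat) (X Y : {fset 'rV[R]_d}) :
    {fset R} :=
  [fset enorm (x - y) | x in X, y in Y & x != y]%fset.

Definition affinely_independent (R : realType) (d : nat)
    (X : {fset 'rV[R]_d}) : Prop :=
  forall f : 'rV[R]_d -> R,
    \sum_(x <- X) f x = 0 -> \sum_(x <- X) f x *: x = 0 ->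
    forall x, x \in X -> f x = 0.

Definition regular_simplex (R : realType) (d : nat)
    (X : {fset 'rV[R]_d}) : Prop :=
  affinely_independent X /\
  exists a : R, forall x y, x \in X -> y \in X -> x != y -> enorm (x - y) = a.

Definition two_design (V : finType) (B : {set {set V}}) (S Lambda : nat) :
    Prop :=
  (forall b, b \in B -> #|b| = S) /\
  (forall P : {set V}, #|P| = 2%N ->
     #|[set b in B | P \subset b]| = Lambda).

Definition quasi_symmetric (V : finType) (B : {set {set V}})
    (alpha beta : nat) : Prop :=
  (beta < alpha)%N /\
  forall t : nat,
    (exists b b' : {set V},
       [/\ b \in B, b' \in B, b != b' & #|b :&: b'| = t])
    <-> (t = beta \/ t = alpha).

Notation block B := {b : {set _} | b \in B}.

(* R^B is the space of row vectors 'rV[R]_#|{: block B}|, with coordinates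
   numbered by enum_rank and enum_val. *)
Definition block_basis (R : realType) (V : finType) (B : {set {set V}})
    (b : block B) : 'rV[R]_#|{: block B}| :=
  delta_mx 0 (enum_rank b).

Definition block_adj (V : finType) (B : {set {set V}}) (alpha : nat) :
    rel (block B) :=
  fun b b' => (b != b') && (#|val b :&: val b'| == alpha).

Definition block_adjmx (R : realType) (V : finType) (B : {set {set V}})
    (alpha : nat) : 'M[R]_#|{: block B}| :=
  \matrix_(j, k) (block_adj alpha (enum_val j : block B) (enum_val k))%:R.

(* Eigenvalues are compared without multiplicity: exactly one eigenvalue is
   greater than r. *)
Definition second_largest_eigenvalue (R : realType) (n : nat) (M : 'M[R]_n)
    (r : R) : Prop :=
  eigenvalue M r /\
  exists2 k : R, eigenvalue M k /\ r < k &
    forall a : R, eigenvalue M a -> a != k -> a <= r.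

Lemma second_largest_eigenvalue_uniq (R : realType) (n : nat) (M : 'M[R]_n)
    (r r' : R) :
  second_largest_eigenvalue M r -> second_largest_eigenvalue M r' -> r = r'.
Proof.
move=> [er [k [ek rk] hk]] [er' [k' [ek' rk'] hk']].
have kk' : k = k'.
  apply/eqP/negPn/negP => nkk'.
  have le1 := hk' _ ek nkk'; rewrite eq_sym in nkk'.
  have le2 := hk _ ek' nkk'.
  have := lt_trans (le_lt_trans le1 rk') (le_lt_trans le2 rk).
  by rewrite ltxx.
subst k'; apply/eqP; rewrite eq_le hk' ?hk //; by rewrite lt_eqF.
Qed.

(* Subspaces are row spaces and maps act on the right; kermx W^T is the
   orthogonal complement of the row space of W. *)
Definition orthogonal_projection (R : realType) (n : nat) (W : 'M[R]_n) :
    'M[R]_n :=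
  proj_mx W (kermx W^T).

(* phi is considered on the row space of W only; its values elsewhere play no
   role. *)
Definition linear_isometry_onto (R : realType) (n d : nat) (W : 'M[R]_n)
    (phi : {linear 'rV[R]_n -> 'rV[R]_d}) : Prop :=
  (forall u : 'rV[R]_n, (u <= W)%MS -> enorm (phi u) = enorm u) /\
  (forall w : 'rV[R]_d, exists2 u : 'rV[R]_n, (u <= W)%MS & phi u = w).

(* Main.v *)
Require Import Defs.
From mathcomp Require Import all_boot all_order all_algebra.
From mathcomp Require Import finmap reals.
From mathcomp Require Import ring lra zify.

Import Order.TTheory GRing.Theory Num.Theory.

Local Open Scope ring_scope.

(** Let N be the point-block incidence matrix, rho the replication number, and
    let the rows of Q be the vertices of a centred regular simplex in R^(m-1),
    so that Q^T Q = 1 and Q Q^T = 1 - J/m.  The vertices themselves represent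
    the points, and the sum of the vertices of the points of b represents the
    block b.  Since N N^T = (rho - Lambda) + Lambda J and
    N^T N = (S - beta) + (alpha - beta) A + beta J, the matrix G = Q^T N
    satisfies G G^T = rho - Lambda and its row space is the r-eigenspace of A,
    for (alpha - beta) r = rho - Lambda - (S - beta).  Hence u |-> u G^T is a
    multiple of an isometry on that eigenspace and vanishes on its orthogonal
    complement, so it sends E_r e_b and e_b to the same vector, the one that
    represents b.  All distances follow from
    |y Q|^2 = |y|^2 - (sum of y)^2 / m. *)

(** * Coordinates of a centred regular simplex *)

Lemma mul_const_mx (R : comPzRingType) (m n p : nat) (a b : R) :
  (const_mx a : 'M_(m, n)) *m (const_mx b : 'M_(n, p))
  = const_mx (n%:R * a * b).
Proof.
apply/matrixP=> i j; rewrite !mxE.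
under eq_bigr do rewrite !mxE.
by rewrite sumr_const card_ord -mulrA mulr_natl.
Qed.

(* The vertices are e_i - t (1, ..., 1) for i < m - 1 together with
   - s (1, ..., 1), where s = 1 / sqrt m and (m - 1) t = 1 - s. *)
Lemma exists_simplex_mx (R : realType) (m : nat) : (0 < m)%N ->
  exists2 Q : 'M[R]_(m, m.-1),
    Q^T *m Q = 1%:M & Q *m Q^T = 1%:M - const_mx m%:R^-1.
Proof.
case: m => // n _ /=.
pose s : R := (Num.sqrt n.+1%:R)^-1; pose t : R := (1 - s) / n%:R.
have m0 : n.+1%:R != 0 :> R by rewrite pnatr_eq0.
have s2 : s * s = n.+1%:R^-1 by rewrite -invfM -expr2 sqr_sqrtr.
(* A single vertex lives in dimension 0 and is treated apart, since [t] has [n] as denominator. *)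
have [n0|n_gt0] := posnP n.
  move: m0 s2; rewrite n0 => _ _; exists 0; first by apply/matrixP=> [[]].
  rewrite mul0mx; apply/matrixP=> i j; rewrite !mxE !ord1 /= invr1; ring.
have n0 : n%:R != 0 :> R by rewrite pnatr_eq0 -lt0n.
have nt : n%:R * t = 1 - s by rewrite /t; field.
clearbody t s.
pose Q : 'M[R]_(1 + n, n) := col_mx (const_mx (- s)) (1%:M - const_mx t).
have QQ : Q^T *m Q = 1%:M.
  have U : (1%:M - const_mx t)^T = 1%:M - const_mx t :> 'M[R]_n.
    by apply/matrixP=> i j; rewrite !mxE eq_sym.
  rewrite tr_col_mx mul_row_col U trmx_const.
  rewrite mulmxBl mul1mx mulmxBr mulmx1 !mul_const_mx.
  have e1 : s * s * (1 + n%:R) = 1 by rewrite s2 nat1r mulVf.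
  (* The all-ones matrix enters Q^T Q with coefficient s^2 + n t^2 - 2 t. Multiplied by n, and with
     n t = 1 - s, this becomes (n + 1) s^2 - 1 = 0. *)
  have e2 : n%:R * (s * s + n%:R * t * t - t - t) = 0.
    have -> : s = 1 - n%:R * t by rewrite nt; ring.
    move: e1; have -> : s = 1 - n%:R * t by rewrite nt; ring.
    by move=> e; lra.
  move/eqP: e2; rewrite mulf_eq0 (negPf n0) /= => /eqP e2.
  by apply/matrixP=> i j; rewrite !mxE; move: (i == j)%:R => x; lra.
exists Q => //.
(* The constant unit column [s1] completes [Q] to a square matrix with orthonormal columns. Its rows
   are then orthonormal too, which reads s1 s1^T + Q Q^T = 1, and s1 s1^T = J/m. *)
pose s1 : 'M[R]_(1 + n, 1) := const_mx s.
have sQ : s1^T *m Q = 0.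
  rewrite /s1 -col_mx_const tr_col_mx mul_row_col !trmx_const.
  rewrite mulmxBr mulmx1 !mul_const_mx.
  apply/matrixP=> i j; rewrite !mxE.
  have -> : n%:R * s * t = s * (1 - s) by rewrite -nt; ring.
  by ring.
have : row_mx s1 Q *m (row_mx s1 Q)^T = 1%:M.
  apply: mulmx1C; rewrite tr_row_mx mul_col_row QQ sQ.
  have -> : Q^T *m s1 = 0 by rewrite -[LHS]trmxK trmx_mul trmxK sQ trmx0.
  rewrite trmx_const mul_const_mx -mulrA s2 mulfV // [RHS]scalar_mx_block.
  by congr block_mx; apply/matrixP=> i j; rewrite !ord1 !mxE.
rewrite tr_row_mx mul_row_col trmx_const mul_const_mx mul1r s2 => <-.
by rewrite addrC addKr.
Qed.

(** * Euclidean norm and orthogonal projection *)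

Lemma mulmx_tr00 {R : comPzRingType} {n : nat} (x y : 'rV[R]_n) :
  (x *m y^T) 0 0 = \sum_j x 0 j * y 0 j.
Proof. by rewrite mxE; under eq_bigr do rewrite mxE. Qed.

Lemma enormE {R : realType} {n : nat} (x : 'rV[R]_n) :
  enorm x = Num.sqrt ((x *m x^T) 0 0).
Proof. by rewrite mulmx_tr00. Qed.

Lemma mulmx_tr_eq0 {R : realType} {n : nat} (x : 'rV[R]_n) :
  x *m x^T = 0 -> x = 0.
Proof.
move=> /matrixP/(_ 0 0); rewrite mulmx_tr00 mxE => /eqP.
rewrite psumr_eq0 => [/allP x0|j _]; last by rewrite -expr2 sqr_ge0.
apply/rowP=> j; rewrite mxE; apply/eqP.
by have := x0 j (mem_index_enum _); rewrite mulf_eq0 orbb.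
Qed.

(** The projections to W and to its orthogonal complement add up to 1, and G^T kills the complement
    because the rows of G lie in W. This is what allows E_r e_b to be replaced by e_b. *)
Lemma mul_orthogonal_projection {R : realType} {n p : nat} (W : 'M[R]_n)
    (G : 'M[R]_(p, n)) :
  (G <= W)%MS -> orthogonal_projection W *m G^T = G^T.
Proof.
move=> sGW; rewrite /orthogonal_projection.
have cap0 : (W :&: kermx W^T = 0)%MS.
  apply/eqP/rowV0P=> u; rewrite sub_capmx => /andP[/submxP[w uE]].
  move=> /sub_kermxP u0; apply: mulmx_tr_eq0.
  by rewrite {2}uE trmx_mul mulmxA u0 mul0mx.
have full : (1%:M <= W + kermx W^T)%MS.
  rewrite sub1mx -col_leq_rank.
  have /mxdirect_addsP := cap0; rewrite mxdirectE /= => /eqP ->.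
  by rewrite mxrank_ker mxrank_tr subnKC // rank_leq_row.
have := add_proj_mx cap0 full; rewrite !mul1mx => e.
rewrite -[RHS]mul1mx -e mulmxDl.
have /submxP[X ->] := sGW.
have /sub_kermxP k0 : (proj_mx (kermx W^T) W <= kermx W^T)%MS.
  by rewrite -[proj_mx _ _]mul1mx proj_mx_sub.
by rewrite trmx_mul !mulmxA k0 mul0mx addr0.
Qed.

(** * Counting in the design by means of its incidence matrix *)

Lemma sum_enum_val {R : nmodType} {T : finType} (F : T -> R) :
  \sum_(i < #|T|) F (enum_val i) = \sum_x F x.
Proof. by rewrite [RHS](big_enum_val F). Qed.

Lemma sumr_mem {R : pzSemiRingType} {T : finType} (A : {set T}) :
  \sum_x (x \in A)%:R = #|A|%:R :> R.
Proof. by rewrite -natr_sum -sum1_card [in RHS]big_mkcond. Qed.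

Lemma sumr_memI {R : pzSemiRingType} {T : finType} (A B : {set T}) :
  \sum_x (x \in A)%:R * (x \in B)%:R = #|A :&: B|%:R :> R.
Proof.
by rewrite -sumr_mem; apply: eq_bigr=> x _; rewrite inE -natrM mulnb.
Qed.

Definition incidence_mx (R : realType) {V : finType} (B : {set {set V}}) :
    'M[R]_(#|V|, #|{: block B}|) :=
  \matrix_(i, j) (enum_val i \in val (enum_val j : block B))%:R.

Lemma block_inter_lt {V : finType} {B : {set {set V}}} {S Lambda : nat}
    {b b' : {set V}} :
  two_design B S Lambda -> b \in B -> b' \in B -> b != b' ->
  (#|b :&: b'| < S)%N.
Proof.
move=> [hS _] bB b'B; apply: contraNltn => le.
by rewrite eqEcard (hS _ bB) (hS _ b'B) leqnn andbT; apply/setIidPl/eqP;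
  rewrite eqEcard subsetIl (hS _ bB).
Qed.

(** All bounds come from two distinct blocks b, b' that meet in alpha points: having equal size,
    neither contains the other, so b misses a point of b'. Moreover 0 <= beta < alpha < S gives two
    points in b, and b is a block through this pair. *)
Lemma quasi_symmetric_design_bounds {V : finType} {B : {set {set V}}}
    {S Lambda alpha beta : nat} :
  two_design B S Lambda -> quasi_symmetric B alpha beta ->
  [/\ (beta < alpha)%N, (alpha < S)%N, (S < #|V|)%N & (0 < Lambda)%N].
Proof.
move=> design [ltba qs].
have [b [b' [bB b'B nbb' bb']]] := (qs alpha).2 (or_intror erefl).
have lt := block_inter_lt design bB b'B nbb'; rewrite bb' in lt.
case: design => hS hL; split=> //.
  have /subsetPn[v vb' vb] : ~~ (b' \subset b).
    apply: contra nbb' => sb'b.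
    by rewrite eq_sym eqEcard sb'b (hS _ bB) (hS _ b'B) leqnn.
  rewrite -(hS _ bB) -cardsT; apply/proper_card/properP.
  by split; [exact: subsetT | exists v].
have : (1 < #|b|)%N by rewrite (hS _ bB); apply: leq_ltn_trans lt; lia.
move=> /card_gt1P[x [y [xb yb nxy]]].
have <- := hL [set x; y]; last by rewrite cards2 nxy.
by apply/card_gt0P; exists b; rewrite inE bB subUset !sub1set xb yb.
Qed.

(** Links sums over the type of blocks, which indexes the columns of the incidence matrix, to the
    cardinalities in which [two_design] is phrased. *)
Lemma sumr_block {R : pzSemiRingType} {V : finType} {B : {set {set V}}}
    (P : pred {set V}) :
  \sum_(b : block B) (P (val b))%:R = #|[set b in B | P b]|%:R :> R.
Proof.
have -> : [set b in B | P b] = val @: [set b : block B | P (val b)].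
  apply/setP=> b; rewrite inE; apply/andP/imsetP => [[bB Pb]|[c]].
    by exists (exist _ b bB); rewrite ?inE.
  by rewrite inE => Pc ->; split=> //; apply: valP.
rewrite (card_imset _ val_inj) -sumr_mem.
by apply: eq_bigr => b _; rewrite inE.
Qed.

Lemma tr_mul_incidence_mx {R : realType} {V : finType} {B : {set {set V}}}
    (j k : 'I_#|{: block B}|) :
  ((incidence_mx R B)^T *m incidence_mx R B) j k
  = #|val (enum_val j : block B) :&: val (enum_val k : block B)|%:R.
Proof.
rewrite mxE -sumr_memI -[RHS]sum_enum_val.
by apply: eq_bigr => i _; rewrite !mxE.
Qed.

(** The entries are intersection sizes: S on the diagonal, alpha for adjacent blocks and beta for
    the other pairs. *)
Lemma tr_mul_incidence_mxE {R : realType} {V : finType} {B : {set {set V}}}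
    {S Lambda alpha beta : nat} :
  two_design B S Lambda -> quasi_symmetric B alpha beta ->
  (incidence_mx R B)^T *m incidence_mx R B
  = (S%:R - beta%:R)%:M + (alpha%:R - beta%:R) *: block_adjmx R B alpha
    + const_mx beta%:R.
Proof.
move=> [hS _] [ltba qs]; apply/matrixP => j k; rewrite tr_mul_incidence_mx.
rewrite !mxE /block_adj (inj_eq enum_val_inj).
have [->|njk] := eqVneq j k.
  by rewrite setIid (hS _ (valP (enum_val k : block B))) /= mulr1n; ring.
have : #|val (enum_val j : block B) :&: val (enum_val k : block B)| = beta \/
       #|val (enum_val j : block B) :&: val (enum_val k : block B)| = alpha.
  apply/qs; exists (val (enum_val j : block B)), (val (enum_val k : block B)).
  split=> //; try exact: valP.
  by rewrite (inj_eq val_inj) (inj_eq enum_val_inj).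
by case=> ->; rewrite /= ?eqxx ?(ltn_eqF ltba) mulr0n ?mulr0n ?mulr1n; ring.
Qed.

Lemma mul_const_incidence_mx {R : realType} {V : finType} {B : {set {set V}}}
    {S Lambda : nat} (n : nat) (a : R) :
  two_design B S Lambda ->
  (const_mx a : 'M_(n, _)) *m incidence_mx R B = const_mx (a * S%:R).
Proof.
move=> [hS _]; apply/matrixP=> i j; rewrite !mxE.
rewrite -(hS _ (valP (enum_val j : block B))) -sumr_mem mulr_sumr.
rewrite -[RHS]sum_enum_val.
by apply: eq_bigr => k _; rewrite !mxE.
Qed.

(** The number of blocks through a point, as a closed formula because [two_design] prescribes only
    the blocks through pairs; [sum_incidence_mx] justifies it. *)
Definition replication_number (R : realType) (V : finType) (S Lambda : nat) :
    R :=
  Lambda%:R * (#|V|%:R - 1) / (S%:R - 1).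

Lemma incidence_mx_mul_tr_offdiag {R : realType} {V : finType}
    {B : {set {set V}}} {S Lambda : nat} (i k : 'I_#|V|) :
  two_design B S Lambda -> i != k ->
  (incidence_mx R B *m (incidence_mx R B)^T) i k = Lambda%:R.
Proof.
move=> [_ hL] nik; rewrite mxE.
have <- := hL [set enum_val i; enum_val k]; last first.
  by rewrite cards2 (inj_eq enum_val_inj) nik.
rewrite -(sumr_block (fun b => [set enum_val i; enum_val k] \subset b)).
rewrite -[RHS]sum_enum_val; apply: eq_bigr => j _.
by rewrite !mxE subUset !sub1set -natrM mulnb.
Qed.

Lemma incidence_mx_mul_tr_diag {R : realType} {V : finType}
    {B : {set {set V}}} (i : 'I_#|V|) :
  (incidence_mx R B *m (incidence_mx R B)^T) i i = \sum_j incidence_mx R B i j.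
Proof.
by rewrite mxE; apply: eq_bigr => j _; rewrite !mxE -natrM mulnb andbb.
Qed.

(** Fix a point v and count the pairs (w, b) with v and w in b. Summing over b first gives S rho;
    summing over w first gives Lambda for each w other than v, and rho for w = v. *)
Lemma sum_incidence_mx {R : realType} {V : finType} {B : {set {set V}}}
    {S Lambda : nat} (i : 'I_#|V|) :
  two_design B S Lambda -> (1 < S)%N ->
  \sum_j incidence_mx R B i j = replication_number R V S Lambda.
Proof.
move=> design S1; set rho := \sum_j _.
have : S%:R * rho = (#|V|%:R - 1) * Lambda%:R + rho.
  have e : incidence_mx R B *m (incidence_mx R B)^T *m const_mx 1
      = incidence_mx R B *m (const_mx S%:R : 'cV_ _).
    rewrite -mulmxA; congr mulmx; rewrite -[LHS]trmxK trmx_mul trmxK trmx_const.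
    by rewrite (mul_const_incidence_mx _ _ design) mul1r trmx_const.
  move/matrixP/(_ i 0): e; rewrite [LHS]mxE (bigD1 i) //=.
  rewrite [const_mx _ _ _]mxE mulr1 incidence_mx_mul_tr_diag => e.
  transitivity ((incidence_mx R B *m (const_mx S%:R : 'cV_ _)) i 0).
    by rewrite mxE mulr_sumr; apply: eq_bigr => j _; rewrite mxE mulrC mxE.
  rewrite -e addrC; congr (_ + _).
  rewrite (eq_bigr (fun=> Lambda%:R)) => [|k nki]; last first.
    rewrite (incidence_mx_mul_tr_offdiag _ _ design) 1?eq_sym //.
    by rewrite mxE mulr1.
  rewrite sumr_const cardC1 card_ord -[LHS]mulr_natl; congr (_ * _).
  by rewrite -subn1 natrB //; apply: leq_ltn_trans (ltn_ord i).
move=> e; rewrite /replication_number.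
have S0 : S%:R - 1 != 0 :> R by rewrite subr_eq0 pnatr_eq1; lia.
by apply: (mulIf S0); rewrite divfK //; lra.
Qed.

Lemma incidence_mx_mul_trE {R : realType} {V : finType} {B : {set {set V}}}
    {S Lambda : nat} :
  two_design B S Lambda -> (1 < S)%N ->
  incidence_mx R B *m (incidence_mx R B)^T
  = (replication_number R V S Lambda - Lambda%:R)%:M + const_mx Lambda%:R.
Proof.
move=> design S1; apply/matrixP=> i k; rewrite [RHS]mxE [const_mx _ _ _]mxE.
have [->|nik] := eqVneq i k.
  rewrite incidence_mx_mul_tr_diag (sum_incidence_mx _ design S1).
  by rewrite mxE eqxx mulr1n subrK.
by rewrite (incidence_mx_mul_tr_offdiag _ _ design nik) mxE (negPf nik) add0r.
Qed.

Lemma incidence_mx_mul_const {R : realType} {V : finType} {B : {set {set V}}}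
    {S Lambda : nat} (n : nat) (a : R) :
  two_design B S Lambda -> (1 < S)%N ->
  incidence_mx R B *m (const_mx a : 'M_(_, n))
  = const_mx (replication_number R V S Lambda * a).
Proof.
move=> design S1; apply/matrixP=> i k.
rewrite !mxE -(sum_incidence_mx i design S1) mulr_suml.
by apply: eq_bigr => j _; rewrite [const_mx _ _ _]mxE.
Qed.

(* The blocks through a point outside a block b0 meet b0 in Lambda * S points
   altogether and in at least beta points each. *)
Lemma beta_replication_lt {R : realType} {V : finType} {B : {set {set V}}}
    {S Lambda alpha beta : nat} :
  two_design B S Lambda -> quasi_symmetric B alpha beta ->
  beta%:R * replication_number R V S Lambda < Lambda%:R * S%:R.
Proof.
move=> design qsym.
have [ltba ltaS _ _] := quasi_symmetric_design_bounds design qsym.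
have S1 : (1 < S)%N by lia.
case: (qsym) => _ qs.
have [b0 [b1 [b0B b1B nb01 b01]]] := (qs alpha).2 (or_intror erefl).
have /subsetPn[v vb1 vb0] : ~~ (b1 \subset b0).
  apply: contra nb01 => sb.
  by rewrite eq_sym eqEcard sb (design.1 _ b0B) (design.1 _ b1B) leqnn.
pose i := enum_rank v.
pose j0 := enum_rank (exist _ b0 b0B : block B).
pose j1 := enum_rank (exist _ b1 b1B : block B).
(* The entry of N N^T N at (v, b0) sums |b :&: b0| over the blocks b through v. Since v is not in
   b0, the formula for N N^T evaluates it to Lambda S. *)
have <- : (incidence_mx R B *m ((incidence_mx R B)^T *m incidence_mx R B)) i j0
          = Lambda%:R * S%:R.
  rewrite mulmxA (incidence_mx_mul_trE design S1) mulmxDl mul_scalar_mx.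
  rewrite (mul_const_incidence_mx _ _ design) !mxE !enum_rankK /=.
  by rewrite (negPf vb0) mulr0 add0r.
rewrite mxE -(sum_incidence_mx i design S1) mulr_sumr.
have le (j : 'I_#|{: block B}|) :
    (beta <= #|val (enum_val j : block B) :&: b0|)%N.
  have [->|nj] := eqVneq (val (enum_val j : block B)) b0.
    by rewrite setIid (design.1 _ b0B); lia.
  have : #|val (enum_val j : block B) :&: b0| = beta \/
         #|val (enum_val j : block B) :&: b0| = alpha.
    apply/qs; exists (val (enum_val j : block B)), b0.
    by split=> //; apply: valP.
  by case=> ->; lia.
(* Strictness comes from b1, which contains v and meets b0 in alpha > beta points. *)
rewrite (bigD1 j1) //= [ltRHS](bigD1 j1) //=; apply: ltr_leD.
  rewrite tr_mul_incidence_mx mxE !enum_rankK /= vb1 mulr1 mul1r ltr_nat.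
  by rewrite setIC b01.
apply: ler_sum => j _; rewrite tr_mul_incidence_mx enum_rankK /= mulrC.
by apply: ler_wpM2l; [rewrite mxE ler0n | rewrite ler_nat; apply: le].
Qed.

(** * Eigenvalues of the block graph *)

Section BlockGraph.

Variables (R : realType) (V : finType) (B : {set {set V}}).
Variables S Lambda alpha beta : nat.
Hypothesis design : two_design B S Lambda.
Hypothesis qsym : quasi_symmetric B alpha beta.

Let N := incidence_mx R B.
Let A := block_adjmx R B alpha.
Let rho := replication_number R V S Lambda.

(* These formulas for k and r express that N^T N has eigenvalue rho S on the
   all-ones vector and rho - Lambda on its complement in the row space of N. *)
Definition block_valency : R :=
  (rho * S%:R - (S%:R - beta%:R) - #|{: block B}|%:R * beta%:R)
  / (alpha%:R - beta%:R).

Definition block_eigenvalue : R :=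
  (rho - Lambda%:R - (S%:R - beta%:R)) / (alpha%:R - beta%:R).

Let S_gt1 : (1 < S)%N.
Proof. by have [? ? _ _] := quasi_symmetric_design_bounds design qsym; lia. Qed.

Let V_gt0 : (0 < #|V|)%N.
Proof. by have [_ _ ? _] := quasi_symmetric_design_bounds design qsym; lia. Qed.

Let ab_gt0 : 0 < alpha%:R - beta%:R :> R.
Proof.
have [? _ _ _] := quasi_symmetric_design_bounds design qsym.
by rewrite subr_gt0 ltr_nat.
Qed.

Let ab_neq0 : alpha%:R - beta%:R != 0 :> R.
Proof. by rewrite gt_eqF. Qed.

Lemma replication_numberE :
  rho * (S%:R - 1) = Lambda%:R * (#|V|%:R - 1).
Proof. by rewrite divfK // subr_eq0 pnatr_eq1; lia. Qed.

Lemma replication_number_gt : 0 < rho - Lambda%:R.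
Proof.
have [_ _ ltSV L0] := quasi_symmetric_design_bounds design qsym.
have S1 : 0 < S%:R - 1 :> R by rewrite subr_gt0 ltr1n.
rewrite -(pmulr_lgt0 _ S1).
have -> : (rho - Lambda%:R) * (S%:R - 1) = Lambda%:R * (#|V|%:R - S%:R).
  by rewrite mulrBl replication_numberE; ring.
by rewrite mulr_gt0 ?ltr0n // subr_gt0 ltr_nat.
Qed.

(** Both sides count the incident pairs of a point and a block. *)
Lemma block_count : #|{: block B}|%:R * S%:R = #|V|%:R * rho.
Proof.
have := erefl ((const_mx 1 : 'rV[R]_ _) *m N *m (const_mx 1 : 'cV_ _)).
rewrite -{1}mulmxA (incidence_mx_mul_const _ _ design S_gt1).
rewrite (mul_const_incidence_mx _ _ design) !mul_const_mx.
by move=> /matrixP/(_ 0 0); rewrite !mxE !mulr1 mul1r.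
Qed.

(** Multiplied by (alpha - beta) S, the difference of the two values is |V| (Lambda S - beta rho),
    which is positive by [beta_replication_lt]. *)
Lemma block_eigenvalue_lt_valency : block_eigenvalue < block_valency.
Proof.
rewrite ltr_pM2r ?invr_gt0 // -subr_gt0.
have S0 : 0 < S%:R :> R by rewrite ltr0n; lia.
rewrite -(pmulr_lgt0 _ S0).
have := beta_replication_lt (R := R) design qsym; rewrite -/rho.
have V0 : 0 < #|V|%:R :> R by rewrite ltr0n.
rewrite -subr_gt0 -(pmulr_lgt0 _ V0) => lt.
set x := (X in 0 < X).
suff -> : x = (Lambda%:R * S%:R - beta%:R * rho) * #|V|%:R by [].
have e1 := replication_numberE; have e2 := block_count.
rewrite /x.
transitivity ((rho * (S%:R - 1) + Lambda%:R) * S%:R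
              - #|{: block B}|%:R * S%:R * beta%:R).
  by ring.
by rewrite e1 e2; ring.
Qed.

Lemma block_adjmxE :
  (alpha%:R - beta%:R) *: A
  = N^T *m N - (S%:R - beta%:R)%:M - const_mx beta%:R.
Proof.
rewrite (tr_mul_incidence_mxE design qsym) [RHS]addrAC addrK.
by rewrite addrAC subrr add0r.
Qed.

Lemma mul_const_block_adjmx :
  (const_mx 1 : 'rV[R]_ _) *m A = block_valency *: const_mx 1.
Proof.
apply: (scalerI ab_neq0); rewrite scalemxAr block_adjmxE !mulmxBr mulmxA.
have -> : const_mx 1 *m N^T = const_mx rho :> 'rV[R]_ _.
  rewrite -[LHS]trmxK trmx_mul trmxK trmx_const.
  by rewrite (incidence_mx_mul_const _ _ design S_gt1) mulr1 trmx_const.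
rewrite (mul_const_incidence_mx _ _ design) mul_mx_scalar mul_const_mx.
by apply/matrixP=> i j; rewrite !mxE /block_valency; field.
Qed.

Lemma block_adjmx_tr : A^T = A.
Proof. by apply/matrixP=> i j; rewrite !mxE /block_adj eq_sym setIC. Qed.

(** As A is symmetric, eigenvectors for t other than the valency are orthogonal to the all-ones
    vector, so the J term of N^T N vanishes on them. The matrix X serves both for one eigenvector
    and for a whole eigenspace. *)
Lemma block_adjmx_eigen {p : nat} {X : 'M[R]_(p, _)} {t : R} :
  X *m A = t *: X -> t != block_valency ->
  X *m (const_mx 1 : 'cV_ _) = 0 /\
  X *m N^T *m N = (S%:R - beta%:R + (alpha%:R - beta%:R) * t) *: X.
Proof.
move=> XA tk.
have X1 : X *m (const_mx 1 : 'cV_ _) = 0.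
  have A1 : A *m (const_mx 1 : 'cV_ _) = block_valency *: const_mx 1.
    rewrite -[LHS]trmxK trmx_mul block_adjmx_tr trmx_const.
    by rewrite mul_const_block_adjmx linearZ /= trmx_const.
  have /eqP : (t - block_valency) *: (X *m (const_mx 1 : 'cV_ _)) = 0.
    by rewrite scalerBl scalemxAl -XA -mulmxA A1 -scalemxAr subrr.
  by rewrite scaler_eq0 subr_eq0 (negPf tk) => /eqP.
split=> //; rewrite -mulmxA (tr_mul_incidence_mxE design qsym).
have -> : const_mx beta%:R
    = (const_mx 1 : 'cV[R]_ _) *m (const_mx beta%:R : 'rV_ _)
    :> 'M_#|{: block B}|.
  by rewrite mul_const_mx !mul1r.
rewrite !mulmxDr mulmxA X1 mul0mx addr0 mul_mx_scalar -scalemxAr XA.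
by rewrite scalerA -scalerDl.
Qed.

Lemma mulmx_tr_incidence_const {p : nat} {X : 'M[R]_(p, _)} :
  X *m (const_mx 1 : 'cV_ _) = 0 -> X *m N^T *m (const_mx 1 : 'cV_ _) = 0.
Proof.
move=> X1; rewrite -mulmxA.
have -> : N^T *m (const_mx 1 : 'cV_ _) = S%:R *: const_mx 1.
  rewrite -[LHS]trmxK trmx_mul trmxK trmx_const.
  rewrite (mul_const_incidence_mx _ _ design).
  by apply/matrixP=> i j; rewrite !mxE mulrC.
by rewrite -scalemxAr X1 scaler0.
Qed.

(** An eigenvector u for t is one of N^T N for s = S - beta + (alpha - beta) t. If s > 0, then u N^T
    is nonzero and is an eigenvector of N N^T for s orthogonal to the all-ones vector, whence s =
    rho - Lambda; otherwise s <= 0 < rho - Lambda. *)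
Lemma block_adjmx_eigenvalue_le (t : R) :
  eigenvalue A t -> t != block_valency -> t <= block_eigenvalue.
Proof.
move=> /eigenvalueP[u uA u0] tk.
have [u1 uNN] := block_adjmx_eigen uA tk.
rewrite /block_eigenvalue ler_pdivlMr // lerBrDr addrC [t * _]mulrC.
set s := _ + _ in uNN *.
have [le0|s_gt0] := lerP s 0.
  exact: le_trans le0 (ltW replication_number_gt).
have : u *m N^T *m N *m N^T = (rho - Lambda%:R) *: (u *m N^T).
  rewrite -mulmxA (incidence_mx_mul_trE design S_gt1) mulmxDr mul_mx_scalar.
  have -> : const_mx Lambda%:R
      = (const_mx 1 : 'cV[R]_ _) *m (const_mx Lambda%:R : 'rV_ _) :> 'M_#|V|.
    by rewrite mul_const_mx !mul1r.
  by rewrite mulmxA mulmx_tr_incidence_const // mul0mx addr0.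
rewrite uNN -scalemxAl => /eqP; rewrite -subr_eq0 -scalerBl scaler_eq0 subr_eq0.
case/orP=> [/eqP -> //|/eqP uN0]; case/negP: u0.
move/eqP: uNN; rewrite uN0 mul0mx eq_sym scaler_eq0 (gt_eqF s_gt0) /=.
by [].
Qed.

(** * The eigenspace and the embedding in simplex coordinates *)

Variable Q : 'M[R]_(#|V|, #|V|.-1).
Hypothesis QtQ : Q^T *m Q = 1%:M.
Hypothesis QQt : Q *m Q^T = 1%:M - const_mx #|V|%:R^-1.

Let G := Q^T *m N.

(** The simplex is centred: Q Q^T kills constant vectors, and Q^T = Q^T Q Q^T. *)
Let tr_simplex_mx_const (n : nat) (a : R) : Q^T *m (const_mx a : 'M_(_, n)) = 0.
Proof.
have V0 : #|V|%:R != 0 :> R by rewrite pnatr_eq0 -lt0n.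
rewrite -[LHS]mul1mx -QtQ -mulmxA [Q *m _]mulmxA QQt mulmxBl mul1mx.
by rewrite mul_const_mx mulfV // mul1r subrr mulmx0.
Qed.

Lemma simplex_incidence_mul_tr : G *m G^T = (rho - Lambda%:R)%:M.
Proof.
rewrite trmx_mul trmxK -mulmxA [N *m _]mulmxA.
rewrite (incidence_mx_mul_trE design S_gt1) mulmxDl mul_scalar_mx mulmxDr.
by rewrite -scalemxAr QtQ scalemx1 mulmxA tr_simplex_mx_const mul0mx addr0.
Qed.

(** Let W be the eigenspace. The rows of W N^T have sum 0, so Q Q^T fixes them, and (W N^T Q) G = W
    N^T N = (rho - Lambda) W puts W in the row space of G. Conversely, G N^T N = (rho - Lambda) G
    and G J = 0. *)
Lemma eigenspace_block_adjmx : (eigenspace A block_eigenvalue :=: G)%MS.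
Proof.
have rk : block_eigenvalue != block_valency.
  by rewrite lt_eqF // block_eigenvalue_lt_valency.
have c0 : rho - Lambda%:R != 0 by rewrite gt_eqF // replication_number_gt.
apply/eqmxP/andP; split.
  have /eigenspaceP/block_adjmx_eigen/(_ rk)[W1 WNN] :=
    submx_refl (eigenspace A block_eigenvalue).
  move: WNN; rewrite /block_eigenvalue [_ * (_ / _)]mulrC divfK //.
  rewrite [_ + (_ - _)]addrC subrK.
  set W := eigenspace _ _ in W1 * => WNN; apply/submxP.
  exists ((rho - Lambda%:R)^-1 *: (W *m N^T *m Q)).
  rewrite /G mulmxA -!scalemxAl -[_ *m Q *m _]mulmxA QQt mulmxBr mulmx1.
  have -> : const_mx #|V|%:R^-1
      = (const_mx 1 : 'cV[R]_ _) *m (const_mx #|V|%:R^-1 : 'rV_ _) :> 'M_#|V|.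
    by rewrite mul_const_mx !mul1r.
  rewrite mulmxA mulmx_tr_incidence_const // mul0mx subr0 WNN.
  by rewrite scalerK.
apply/eigenspaceP; apply: (scalerI ab_neq0).
rewrite scalemxAr block_adjmxE !mulmxBr mul_mx_scalar.
have -> : G *m (const_mx beta%:R : 'M_#|{: block B}|) = 0.
  rewrite /G -mulmxA (incidence_mx_mul_const _ _ design S_gt1).
  exact: tr_simplex_mx_const.
rewrite /G mulmxA -[_ *m N *m _]mulmxA (incidence_mx_mul_trE design S_gt1).
rewrite mulmxDr tr_simplex_mx_const mul_mx_scalar addr0 -scalemxAl subr0.
rewrite -scalerBl scalerA.
by rewrite /block_eigenvalue mulrC divfK.
Qed.

(* The sum of the simplex vertices that belong to the points of X. *)
Definition char_point (X : {set V}) : 'rV[R]_#|V|.-1 :=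
  (\row_i (enum_val i \in X)%:R) *m Q.

Lemma row_simplex_mx (v : V) : row (enum_rank v) Q = char_point [set v].
Proof.
rewrite rowE /char_point; congr mulmx; apply/rowP=> i; rewrite !mxE inE.
by rewrite -(inj_eq enum_val_inj) enum_rankK.
Qed.

Lemma row_simplex_incidence_mx (b : block B) :
  row (enum_rank b) G^T = char_point (val b).
Proof.
rewrite rowE /G trmx_mul trmxK mulmxA -rowE /char_point; congr mulmx.
by apply/rowP=> i; rewrite !mxE enum_rankK.
Qed.

Lemma enorm_char_pointB (X Y : {set V}) :
  enorm (char_point X - char_point Y)
  = Num.sqrt (#|X|%:R + #|Y|%:R - 2 * #|X :&: Y|%:R
              - (#|X|%:R - #|Y|%:R) ^+ 2 / #|V|%:R).
Proof.
rewrite /char_point -mulmxBl enormE trmx_mul mulmxA; set y := _ - _.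
rewrite -[y *m Q *m _]mulmxA QQt mulmxBr mulmx1 mulmxBl.
have yE (i : 'I_#|V|) : y 0 i = (enum_val i \in X)%:R - (enum_val i \in Y)%:R.
  by rewrite !mxE.
have y1 : \sum_i y 0 i = #|X|%:R - #|Y|%:R.
  under eq_bigr do rewrite yE.
  rewrite (sum_enum_val (fun v => (v \in X)%:R - (v \in Y)%:R)).
  by rewrite sumrB !sumr_mem.
congr Num.sqrt; rewrite mxE [X in _ + X]mxE mulmx_tr00; congr (_ - _).
  under eq_bigr do rewrite yE.
  rewrite (sum_enum_val (fun v => ((v \in X)%:R - (v \in Y)%:R) *
                                  ((v \in X)%:R - (v \in Y)%:R))).
  rewrite -sumr_memI -!sumr_mem mulr_sumr -big_split -sumrB /=.
  apply: eq_bigr => v _; case: (v \in X); case: (v \in Y);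
    by rewrite ?mulr0n ?mulr1n; ring.
have -> : y *m const_mx #|V|%:R^-1
    = const_mx ((#|X|%:R - #|Y|%:R) / #|V|%:R) :> 'rV_#|V|.
  apply/rowP=> i; rewrite [LHS]mxE -y1 mulr_suml mxE.
  by apply: eq_bigr => j _; rewrite [const_mx _ _ _]mxE.
rewrite mulmx_tr00; under eq_bigr do rewrite mxE.
by rewrite -mulr_sumr y1 mulrAC expr2.
Qed.

(** * Multiplicity of the eigenvalue and the isometry from its eigenspace *)

Lemma rank_eigenspace_block_adjmx :
  \rank (eigenspace A block_eigenvalue) = #|V|.-1.
Proof.
have c0 : rho - Lambda%:R != 0 by rewrite gt_eqF // replication_number_gt.
rewrite eigenspace_block_adjmx; apply/eqP/row_freeP.
exists ((rho - Lambda%:R)^-1 *: G^T).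
by rewrite -scalemxAr simplex_incidence_mul_tr scale_scalar_mx mulVf.
Qed.

Lemma second_largest_block_eigenvalue :
  second_largest_eigenvalue A block_eigenvalue.
Proof.
have [ltba ltaS ltSV _] := quasi_symmetric_design_bounds design qsym.
split.
  by rewrite /eigenvalue -mxrank_eq0 rank_eigenspace_block_adjmx; lia.
exists block_valency; last exact: block_adjmx_eigenvalue_le.
split; last exact: block_eigenvalue_lt_valency.
apply/eigenvalueP; exists (const_mx 1); first exact: mul_const_block_adjmx.
(* The all-ones vector is nonzero because there is a block. *)
have [b [_ [bB _ _ _]]] := (qsym.2 alpha).2 (or_intror erefl).
apply/eqP => /rowP/(_ (enum_rank (exist _ b bB : block B))).
by rewrite !mxE; apply/eqP; rewrite oner_eq0.
Qed.

Definition eigenspace_isometry_mx : 'M[R]_(#|{: block B}|, #|V|.-1) :=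
  (Num.sqrt (rho - Lambda%:R))^-1 *: G^T.

(** Every vector of the eigenspace is some w G. Its norm is c |w| with c^2 = rho - Lambda, since G
    G^T = c^2, and its image is c w; so c^-1 w G is sent to w. *)
Lemma eigenspace_isometryP :
  linear_isometry_onto (eigenspace A block_eigenvalue)
    (mulmxr eigenspace_isometry_mx).
Proof.
have c0 := replication_number_gt.
set c := Num.sqrt (rho - Lambda%:R).
have cc : c * c = rho - Lambda%:R by rewrite -expr2 sqr_sqrtr // ltW.
have cn0 : c != 0 by rewrite gt_eqF // sqrtr_gt0.
split=> [u|w].
  rewrite eigenspace_block_adjmx => /submxP[w ->] /=.
  rewrite /eigenspace_isometry_mx -/c -scalemxAr -mulmxA.
  rewrite simplex_incidence_mul_tr -cc mul_mx_scalar scalerA mulKf //.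
  rewrite !enormE [(w *m G)^T]trmx_mul mulmxA -[w *m G *m _]mulmxA.
  rewrite simplex_incidence_mul_tr -cc mul_mx_scalar linearZ /=.
  by rewrite -!scalemxAl -scalemxAr scalerA.
exists (c^-1 *: w *m G).
  by rewrite eigenspace_block_adjmx submxMl.
rewrite /= /eigenspace_isometry_mx -/c -scalemxAr -mulmxA.
rewrite simplex_incidence_mul_tr -cc mul_mx_scalar !scalerA.
by rewrite mulKf // mulfV // scale1r.
Qed.

Lemma char_point_blockE (b : block B) :
  char_point (val b) = Num.sqrt (rho - Lambda%:R) *:
    mulmxr eigenspace_isometry_mx
      (block_basis R b
       *m orthogonal_projection (eigenspace A block_eigenvalue)).
Proof.
have c0 : Num.sqrt (rho - Lambda%:R) != 0.
  by rewrite gt_eqF // sqrtr_gt0 replication_number_gt.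
rewrite /= /eigenspace_isometry_mx -scalemxAr scalerA mulfV // scale1r -mulmxA.
rewrite mul_orthogonal_projection; last by rewrite eigenspace_block_adjmx.
by rewrite -rowE row_simplex_incidence_mx.
Qed.

(** * Distances between the vectors of points and blocks *)

Lemma enorm_point (v w : V) :
  v != w -> enorm (char_point [set v] - char_point [set w]) = Num.sqrt 2.
Proof.
move=> nvw; rewrite enorm_char_pointB !cards1.
have -> : #|[set v] :&: [set w]| = 0%N.
  by apply/eqP; rewrite cards_eq0 setI_eq0 disjoints1 inE.
by congr Num.sqrt; ring.
Qed.

Lemma enorm_block (b b' : block B) :
  enorm (char_point (val b) - char_point (val b'))
  = Num.sqrt (2 * (S%:R - #|val b :&: val b'|%:R)).
Proof.
rewrite enorm_char_pointB (design.1 _ (valP b)) (design.1 _ (valP b')).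
by congr Num.sqrt; ring.
Qed.

Lemma enorm_point_block (v : V) (b : block B) :
  enorm (char_point [set v] - char_point (val b))
  = Num.sqrt (1 + S%:R - 2 * (v \in val b)%:R - (1 - S%:R) ^+ 2 / #|V|%:R).
Proof.
rewrite enorm_char_pointB cards1 (design.1 _ (valP b)).
congr (Num.sqrt (_ - _ * _ - _)); rewrite setIC.
case: (boolP (v \in val b)) => vb.
  by have /setIidPr -> : [set v] \subset val b; rewrite ?sub1set // cards1.
suff -> : val b :&: [set v] = set0 by rewrite cards0.
by apply/eqP; rewrite setI_eq0 disjoint_sym disjoints1.
Qed.

Lemma char_point1_inj : injective (fun v : V => char_point [set v]).
Proof.
move=> v w e; apply/eqP/negPn/negP => /enorm_point.
rewrite e subrr enormE mul0mx mxE sqrtr0 => /esym/eqP.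
by rewrite gt_eqF // sqrtr_gt0 ltr0n.
Qed.

Lemma sum_fset_point {T : nmodType} (F : 'rV[R]_#|V|.-1 -> T) :
  \sum_(x <- [fset char_point [set v] | v : V in V]%fset) F x
  = \sum_(v : V) F (char_point [set v]).
Proof.
rewrite big_imfset /=; last by move=> v w _ _; apply: char_point1_inj.
by rewrite big_enum.
Qed.

(** An affine dependence is a row y with y Q = 0 and coordinate sum 0, hence y = y (Q Q^T + J/m) =
    0. *)
Lemma regular_simplex_point :
  regular_simplex [fset char_point [set v] | v : V in V]%fset.
Proof.
split; last first.
  exists (Num.sqrt 2) => _ _ /imfsetP[v _ ->] /imfsetP[w _ ->] nvw.
  by apply: enorm_point; apply: contra nvw => /eqP ->.
move=> f; rewrite !sum_fset_point => f0 fx0.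
pose y := \row_(i < #|V|) f (char_point [set enum_val i]).
have yQ : y *m Q = 0.
  rewrite mulmx_sum_row -[RHS]fx0.
  rewrite -(sum_enum_val
              (fun v => f (char_point [set v]) *: char_point [set v])).
  by apply: eq_bigr => i _; rewrite mxE -row_simplex_mx enum_valK.
have y1 : y *m (const_mx #|V|%:R^-1 : 'M_#|V|) = 0.
  apply/rowP=> j; rewrite !mxE; under eq_bigr do rewrite !mxE.
  rewrite -mulr_suml (sum_enum_val (fun v => f (char_point [set v]))).
  by rewrite f0 mul0r.
have y0 : y = 0.
  by rewrite -[y]subr0 -y1 -{1}[y]mulmx1 -mulmxBr -QQt mulmxA yQ mul0mx.
move=> _ /imfsetP[v _ ->]; move/rowP/(_ (enum_rank v)): y0.
by rewrite !mxE enum_rankK.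
Qed.

End BlockGraph.

(** * Distance sets of the embedded points and blocks *)

Lemma distancesP {R : realType} {d : nat} {X Y : {fset 'rV[R]_d}} {z : R} :
  reflect (exists x y, [/\ x \in X, y \in Y, x != y & z = enorm (x - y)])
          (z \in distances X Y).
Proof.
apply: (iffP (imfset2P _ _ _ _ _)) => [[x xX [y]]|[x [y [xX yY nxy ->]]]].
  by rewrite !inE => /andP[yY nxy] ->; exists x, y.
by exists x => //; exists y => //; rewrite !inE yY.
Qed.


Theorem theorem1 (R : realType) (V : finType) (B : {set {set V}})
    (S Lambda alpha beta : nat)
    (design : two_design B S Lambda)
    (qsym : quasi_symmetric B alpha beta) :
  exists r : R,
    let A := block_adjmx R B alpha in
    let W := eigenspace A r in
    let Er := orthogonal_projection W in
    let d := #|V|.-1 in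
    [/\ second_largest_eigenvalue A r,
        \rank W = d
      & exists i : V + block B -> 'rV[R]_d,
        let X1 := [fset i (inl v) | v : V in V]%fset in
        let X2 := [fset i (inr b) | b : block B in {: block B}]%fset in
        [/\ regular_simplex X1 /\ #|` X1|%fset = #|V|,
            exists (o : 'rV[R]_d) (c : R)
                   (phi : {linear 'rV[R]_#|{: block B}| -> 'rV[R]_d}),
              [/\ 0 < c, linear_isometry_onto W phi
                & forall b : block B,
                    i (inr b) = o + c *: phi (block_basis R b *m Er)],
            forall (v v' : V) (b b' : block B),
              (v \in val b) = (v' \in val b') ->
              enorm (i (inl v) - i (inr b)) = enorm (i (inl v') - i (inr b'))
          & [/\ #|` distances X1 X1|%fset = 1%N,
                #|` distances X1 X2|%fset = 2%N
              & #|` distances X2 X2|%fset = 2%N]]].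
Proof.
have [ltba ltaS ltSV L0] := quasi_symmetric_design_bounds design qsym.
have S_gt1 : (1 < S)%N by lia.
have V_gt0 : (0 < #|V|)%N by lia.
have ltbS := ltn_trans ltba ltaS.
have V0 : 0 < #|V|%:R :> R by rewrite ltr0n.
have S1 : 1 < S%:R :> R by rewrite ltr1n.
have SV : S%:R < #|V|%:R :> R by rewrite ltr_nat.
have [Q QtQ QQt] := exists_simplex_mx R #|V| V_gt0.
exists (block_eigenvalue R V S Lambda alpha beta) => A W Er d; split.
- exact: (second_largest_block_eigenvalue R _ _ _ _ _ _ design qsym Q).
- exact: (rank_eigenspace_block_adjmx R _ _ _ _ _ _ design qsym Q).
exists (fun x => match x with
  | inl v => char_point R V Q [set v]
  | inr b => char_point R V Q (val b)
  end) => X1 X2; split.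
- split; first exact: regular_simplex_point.
  rewrite card_imfset /= -?cardE //; exact: char_point1_inj.
(* The centre is the origin because the simplex is centred; the factor undoes the normalisation in
   [eigenspace_isometry_mx]. *)
- exists 0, (Num.sqrt (replication_number R V S Lambda - Lambda%:R)).
  exists (mulmxr (eigenspace_isometry_mx R V B S Lambda Q)); split.
  + by rewrite sqrtr_gt0 (replication_number_gt R _ _ _ _ _ _ design qsym).
  + exact: eigenspace_isometryP.
  + by move=> b; rewrite add0r (char_point_blockE R _ _ _ _ _ _ design qsym).
- move=> v v' b b' e.
  by rewrite !(enorm_point_block R _ _ _ _ design _ QQt) e.
have X1P x : reflect (exists v, x = char_point R V Q [set v]) (x \in X1).
  by apply: (iffP (imfsetP _ _ _ _)) => [[v _ ->]|[v ->]]; exists v.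
have X2P x :
    reflect (exists b : block B, x = char_point R V Q (val b)) (x \in X2).
  by apply: (iffP (imfsetP _ _ _ _)) => [[b _ ->]|[b ->]]; exists b.
(* [distances] takes only pairs of distinct vectors, so each value has to be shown nonzero before it
   counts. *)
have enorm_neq0 (x y : 'rV[R]_d) : enorm (x - y) != 0 -> x != y.
  by apply: contra => /eqP ->; rewrite subrr enormE mul0mx mxE sqrtr0.
have [b0 [b1 [b0B b1B nb01 b01]]] := (qsym.2 alpha).2 (or_intror erefl).
have [c0 [c1 [c0B c1B nc01 c01]]] := (qsym.2 beta).2 (or_introl erefl).
(* The points v0 in b0 and w outside b0 realize the two distances between points and blocks; v0 and
   v1 realize the one between points. *)
have /card_gt1P[v0 [v1 [v0b v1b nv01]]] : (1 < #|b0|)%N.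
  by rewrite (design.1 _ b0B).
have /properP[_ [w _ wb0]] : b0 \proper [set: V].
  by rewrite properEcard subsetT cardsT (design.1 _ b0B).
split.
- suff -> : distances X1 X1 = [fset Num.sqrt 2]%fset by rewrite cardfs1.
  apply/fsetP=> z; rewrite !inE; apply/distancesP/eqP => [[x [y []]]|->].
    move=> /X1P[v ->] /X1P[v' ->] nvv' ->; apply: enorm_point => //.
    by apply: contra nvv' => /eqP ->.
  exists (char_point R V Q [set v0]), (char_point R V Q [set v1]).
  split; [by apply/X1P; exists v0 | by apply/X1P; exists v1 | | ].
    by rewrite (inj_eq (char_point1_inj R V Q QQt)).
  by rewrite enorm_point.
- pose dist (e : bool) : R :=
    Num.sqrt (1 + S%:R - 2 * e%:R - (1 - S%:R) ^+ 2 / #|V|%:R).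
  have radicand_gt0 (e : bool) :
      0 < 1 + S%:R - 2 * e%:R - (1 - S%:R) ^+ 2 / #|V|%:R :> R.
    (* The claim is (S - 1)^2 < (S - 1) |V| for an incident pair and (S - 1)^2 < (S + 1) |V|
       otherwise; both follow from 1 < S < |V|. *)
    rewrite subr_gt0 ltr_pdivrMr //; clear - S1 SV V0.
    by case: e; rewrite ?mulr1n ?mulr0n; nra.
  have -> : distances X1 X2 = [fset dist true; dist false]%fset.
    have distE (v : V) (b : block B) :
        enorm (char_point R V Q [set v] - char_point R V Q (val b))
        = dist (v \in val b).
      exact: (enorm_point_block R V B S Lambda design Q QQt).
    have dist_in (v : V) (b : block B) : dist (v \in val b) \in distances X1 X2.
      apply/distancesP.
      exists (char_point R V Q [set v]), (char_point R V Q (val b)).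
      split; [by apply/X1P; exists v | by apply/X2P; exists b | | by []].
      by apply: enorm_neq0; rewrite distE gt_eqF // sqrtr_gt0.
    apply/fsetP=> z; rewrite !inE; apply/idP/orP => [/distancesP[x [y []]]|].
      move=> /X1P[v ->] /X2P[b ->] _ ->; rewrite distE.
      by case: (v \in val b); [left | right].
    case=> /eqP ->.
      by have := dist_in v0 (exist _ b0 b0B); rewrite /= v0b.
    by have := dist_in w (exist _ b0 b0B); rewrite /= (negPf wb0).
  rewrite cardfs2 eqr_sqrt ?ltW //.
  rewrite (inj_eq (addIr _)) (inj_eq (addrI _)) eqr_opp.
  by rewrite (inj_eq (mulfI _)) ?pnatr_eq0.
- pose dist (t : nat) : R := Num.sqrt (2 * (S%:R - t%:R)).
  have radicand_gt0 (t : nat) : (t < S)%N -> 0 < 2 * (S%:R - t%:R) :> R.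
    by move=> tS; rewrite mulr_gt0 // subr_gt0 ltr_nat.
  have dist_gt0 (t : nat) : (t < S)%N -> 0 < dist t.
    by move=> tS; rewrite sqrtr_gt0 radicand_gt0.
  have -> : distances X2 X2 = [fset dist alpha; dist beta]%fset.
    have dist_in (b b' : {set V}) : b \in B -> b' \in B -> b != b' ->
        dist #|b :&: b'| \in distances X2 X2.
      move=> bB b'B nbb'; apply/distancesP.
      exists (char_point R V Q b), (char_point R V Q b').
      have distE :
          enorm (char_point R V Q b - char_point R V Q b') = dist #|b :&: b'|.
        exact: (enorm_block R V B S Lambda design Q QQt
                  (exist _ b bB) (exist _ b' b'B)).
      split; [by apply/X2P; exists (exist _ b bB) |
              by apply/X2P; exists (exist _ b' b'B) | | by []].
      apply: enorm_neq0; rewrite distE gt_eqF // dist_gt0 //.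
      exact: (block_inter_lt design).
    apply/fsetP=> z; rewrite !inE; apply/idP/orP => [/distancesP[x [y []]]|].
      move=> /X2P[b ->] /X2P[b' ->] nbb' ->.
      rewrite (enorm_block R V B S Lambda design Q QQt).
      have : #|val b :&: val b'| = beta \/ #|val b :&: val b'| = alpha.
        apply/qsym.2; exists (val b), (val b'); split=> //; try exact: valP.
        by apply: contra nbb' => /eqP ->.
      by case=> ->; [right | left].
    case=> /eqP ->; first by rewrite -b01; apply: dist_in.
    by rewrite -c01; apply: dist_in.
  rewrite cardfs2.
  rewrite (eqr_sqrt (ltW (radicand_gt0 _ ltaS)) (ltW (radicand_gt0 _ ltbS))).
  have two_neq0 : 2 != 0 :> R by rewrite pnatr_eq0.
  rewrite (inj_eq (mulfI two_neq0)) (inj_eq (addrI _)) eqr_opp eqr_nat.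
  by rewrite gtn_eqF.
Qed.
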